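(* Let $S$ be a finite unsatisfiable set of propositional clauses, let $U$ be a support set for $S$, and let $Step$ be the stepping sequence for $S$ and $U$. Suppose the procedure $DPLL\text{-}Rel(S,Step)$ is called at the top level. Then the number of recursive calls to $DPLL\text{-}Rel(Q,StepR)$ (for the various clause sets $Q$ and stepping remainder sequences $StepR$ that arise) is bounded by $2^k$, where $k$ is the number of literals in the $U$ support neighborhood for $S$, i.e. the number of distinct literals occurring in clauses of the $U$ support neighborhood for $S$.
   Context: A literal is an atom $A$ or its negation $\neg A$; $\neg\neg A$ is identified with $A$. A clause is a finite set of literals, read as their disjunction; the empty clause denotes false. $\equiv$ denotes syntactic identity of literals. **Alternating paths (propositional case).** An alternating path from $C_1$ to $C_n$ in a set $S$ of clauses is a sequence $C_1,p_1,C_2,p_2,\dots,p_{n-1},C_n$ with all $C_i\in S$, where each $p_i=(L_i,M_{i+1})$ with $L_i\in C_i$, $M_{i+1}\in C_{i+1}$, $L_i\equiv\neg M_{i+1}$, and $L_i\not\equiv M_i$ for $1<i<n$. Its length is $n$ (so a single clause is a path of length 1). The relevance distance $d_S(C,D)$ is the length of a shortest alternating path in $S$ from $C$ to $D$, or $\infty$ if there is none. For $T\subseteq S$, $d_S(T,C)=\min\{d_S(D,C):D\in T\}$ and $R_{m,S}(T)=\{C\in S: d_S(T,C)\le m\}$. **Support sets.** A support set for $S$ is a subset $U\subseteq S$ such that every unsatisfiable subset of $S$ has non-empty intersection with $U$. For unsatisfiable $S$, the $U$ support radius for $S$ is the minimal $m$ such that $R_{m,S}(U)$ is unsatisfiable,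 and the $U$ support neighborhood for $S$ is $R_{m,S}(U)$ for this $m$. **Stepping sequences.** For a literal $L$, the relevance distance $d(U,L)$ is the minimal $n$ such that $L$ or its negation appears in a clause of $S$ at relevance distance $n$ from $U$. For a set $T$ of clauses, $\mathcal{L}(T)=\bigcup T$ is the set of literals in clauses of $T$. The stepping sequence for $S$ and $U$ is $(\mathcal{L}_1,\dots,\mathcal{L}_n)$, where $\mathcal{L}_i$ is the set of literals of $S$ at relevance distance $i$ from $U$ and $n$ is the maximum finite relevance distance from $U$ of any literal in $S$. A stepping remainder sequence for $S$ and $U$ is a sequence $(\mathcal{L}'_1,\dots,\mathcal{L}'_n)$ with $\mathcal{L}'_i\subseteq\mathcal{L}_i$ for all $i$. A leading literal of it is an element of $\mathcal{L}'_i$, or the complement of such an element, where $i$ is minimal such that $\mathcal{L}'_i\neq\emptyset$. For $StepR=(\mathcal{L}'_1,\dots,\mathcal{L}'_n)$ and a clause set $T$, $StepR:T$ denotes $(\mathcal{L}'_1\cap\mathcal{L}(T),\dots,\mathcal{L}'_n\cap\mathcal{L}(T))$, and $|StepR|=\sum_i|\mathcal{L}'_i|$. **The procedure.** For a clause set $Q$ and a literal $L$, $Q|L$ is $Q$ with all clauses containing $L$ deleted and $\neg L$ removed from all clauses containing $\neg L$; $Q|\neg L$ is defined in the same way with signs reversed. The recursive procedure $DPLL\text{-}Rel(Q,StepR)$ is: 1. If the empty clause is in $Q$, return ''unsat''. 2. Otherwise, if $|StepR|=0$, return ''sat''. 3. Otherwise choose $L$ to be a leading literal of $StepR$ (any leading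 literal may be chosen). 4. If $DPLL\text{-}Rel(Q|L,\ StepR:(Q|L))$ returns ''unsat'', then return the result of $DPLL\text{-}Rel(Q|\neg L,\ StepR:(Q|\neg L))$. 5. Otherwise return ''sat''. No unit rules or clause learning are used. *)

(* Defs.v *)
From mathcomp Require Import all_boot.
From mathcomp Require Import finmap.
From mathcomp Require Import boolp.

Set Implicit Arguments.
Unset Strict Implicit.
Unset Printing Implicit Defensive.

Local Open Scope fset_scope.

(* The least natural number satisfying P; None stands for infinity. *)
Definition min_nat (P : nat -> Prop) : option nat :=
  if pselect (exists n, `[< P n >]) is left exP then Some (ex_minn exP)
  else None.

(* (true, a) is the atom a and (false, a) its negation. *)
Definition literal (T : choiceType) : choiceType := (bool * T)%type.
Definition clause (T : choiceType) : choiceType := {fset literal T}.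
Definition clauses (T : choiceType) : choiceType := {fset clause T}.

Section Definitions.
Variable T : choiceType.
Implicit Types (L : literal T) (C D : clause T) (S U V N Q : clauses T).

Definition neg L : literal T := (~~ L.1, L.2).

Definition lits Q : {fset literal T} := \bigcup_(C <- Q) C.

Definition lit_true (v : T -> bool) L : bool := v L.2 == L.1.

Definition satisfiable Q : Prop :=
  exists v : T -> bool,
    forall C, C \in Q -> exists2 L, L \in C & lit_true v L.

(* The sequence C_1, (L_1, M_2), C_2, ..., (L_(n-1), M_n), C_n; only the
   values Cs i for 1 <= i <= n, Ls i for 1 <= i < n and Ms i for 1 < i <= n
   matter. *)
Definition alternating_path S (n : nat) (Cs : nat -> clause T)
    (Ls Ms : nat -> literal T) : Prop :=
  [/\ 1 <= n,
      forall i, 1 <= i <= n -> Cs i \in S,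
      forall i, 1 <= i < n ->
        [/\ Ls i \in Cs i, Ms i.+1 \in Cs i.+1 & Ls i = neg (Ms i.+1)]
    & forall i, 1 < i < n -> Ls i <> Ms i].

Definition dist S C D : option nat :=
  min_nat (fun n => exists Cs Ls Ms,
    [/\ alternating_path S n Cs Ls Ms, Cs 1 = C & Cs n = D]).

Definition set_dist S V C : option nat :=
  min_nat (fun n => exists2 D, D \in V & dist S D C = Some n).

Definition relevant S V (m : nat) : clauses T :=
  [fset C in S | if set_dist S V C is Some n then n <= m else false].

Definition support_set S U : Prop :=
  U `<=` S /\ forall V, V `<=` S -> ~ satisfiable V -> V `&` U != fset0.

Definition support_radius S U : option nat :=
  min_nat (fun m => ~ satisfiable (relevant S U m)).

(* The radius is finite whenever S is unsatisfiable and U is a support set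
   for S, so the value fset0 is then irrelevant. *)
Definition support_neighborhood S U : clauses T :=
  if support_radius S U is Some m then relevant S U m else fset0.

Definition lit_dist S U L : option nat :=
  min_nat (fun n => exists C,
    [/\ C \in S, set_dist S U C = Some n & (L \in C) || (neg L \in C)]).

Definition stepping_level S U (i : nat) : {fset literal T} :=
  [fset L in lits S | lit_dist S U L == Some i].

(* The levels are indexed from 1; infinite distances are ignored by the
   maximum. *)
Definition stepping_sequence S U : seq {fset literal T} :=
  [seq stepping_level S U i
     | i <- iota 1 (\max_(L <- lits S) odflt 0 (lit_dist S U L))].

Implicit Types StepR : seq {fset literal T}.

Definition leading StepR L : Prop :=
  exists i, [/\ forall j, j < i -> nth fset0 StepR j = fset0,
                nth fset0 StepR i != fset0
              & (L \in nth fset0 StepR i) || (neg L \in nth fset0 StepR i)].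

Definition step_restrict StepR Q : seq {fset literal T} :=
  [seq X `&` lits Q | X <- StepR].

Definition step_size StepR : nat := \sum_(X <- StepR) #|` X|.

Definition assign Q L : clauses T :=
  [fset C `\ neg L | C in [fset C in Q | L \notin C]].

Inductive answer := Unsat | Sat.

(* dpll_rel Q StepR r c: some execution of the call DPLL-Rel(Q, StepR), with
   its choices of leading literals, returns r and consists of c calls
   altogether, the call itself included.  A recursive call always has a smaller
   step_size, so every execution terminates and is described by a derivation. *)
Inductive dpll_rel : clauses T -> seq {fset literal T} -> answer -> nat -> Prop :=
| dpll_empty Q StepR :
    fset0 \in Q ->
    dpll_rel Q StepR Unsat 1
| dpll_exhausted Q StepR :
    fset0 \notin Q -> step_size StepR = 0 ->
    dpll_rel Q StepR Sat 1
| dpll_first Q StepR L c :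
    fset0 \notin Q -> step_size StepR <> 0 -> leading StepR L ->
    dpll_rel (assign Q L) (step_restrict StepR (assign Q L)) Sat c ->
    dpll_rel Q StepR Sat c.+1
| dpll_second Q StepR L c1 r c2 :
    fset0 \notin Q -> step_size StepR <> 0 -> leading StepR L ->
    dpll_rel (assign Q L) (step_restrict StepR (assign Q L)) Unsat c1 ->
    dpll_rel (assign Q (neg L)) (step_restrict StepR (assign Q (neg L))) r c2 ->
    dpll_rel Q StepR r (c1 + c2).+1.

End Definitions.

(* Main.v *)
(** A model [v] of the clauses reachable from [U] would yield a model of [S]:
    follow only the alternating paths that leave every clause through a literal
    true in [v], make these literals true, and take a model of [S `\` U]
    elsewhere.  Hence some [R_{m,S}(U)] is unsatisfiable.  Along a run of the
    procedure, what remains of the support neighborhood stays unsatisfiable, so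
    while the empty clause is absent some literal of it remains, and every
    leading literal has its atom in the neighborhood.  The recursion tree thus
    has depth at most the number [a] of these atoms, hence fewer than [2^(a+1)]
    nodes, and [a < k] because some atom occurs with both signs. *)
Require Import Defs.
From mathcomp Require Import all_boot finmap.
From mathcomp Require Import boolp zify.
Local Open Scope fset_scope.

Set Implicit Arguments.
Unset Strict Implicit.
Unset Printing Implicit Defensive.

(** * Least natural numbers *)

Lemma min_nat_exists (P : nat -> Prop) n :
  P n -> exists2 m, min_nat P = Some m & m <= n.
Proof.
move=> Pn; rewrite /min_nat; case: pselect => [exP|[]]; last first.
  by exists n; apply/asboolP.
by case: ex_minnP => m _ min_m; exists m => //; apply/min_m/asboolP.
Qed.

Lemma min_nat_holds (P : nat -> Prop) m : min_nat P = Some m -> P m.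
Proof.
rewrite /min_nat; case: pselect => // exP [<-].
by case: ex_minnP => k /asboolP.
Qed.

(** * Literals, assignments and atoms *)

Section Literals.
Variable T : choiceType.
Implicit Types (L : literal T) (C : clause T) (Q N : clauses T).

Lemma negK : involutive (@neg T).
Proof. by case=> b a; rewrite /neg /= negbK. Qed.

Lemma lit_true_neg v L : lit_true v (neg L) = ~~ lit_true v L.
Proof. by rewrite /lit_true /=; case: (v _); case: L.1. Qed.

Lemma eq_atom L M : M.2 = L.2 -> M = L \/ M = neg L.
Proof.
case: L M => [b a] [d e] /= ->; rewrite /neg /=.
by case: b d => [] []; [left|right|right|left].
Qed.

Lemma litsP Q L : reflect (exists2 C, C \in Q & L \in C) (L \in lits Q).
Proof.
apply: (iffP (bigfcupP _ _ _ _)) => [[C]|[C CQ LC]].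
  by rewrite andbT; exists C.
by exists C; rewrite ?CQ.
Qed.

Lemma assignP Q L D :
  reflect (exists C, [/\ C \in Q, L \notin C & D = C `\ neg L])
    (D \in assign Q L).
Proof.
apply: (iffP (imfsetP _ _ _ _)) => /= [[C]|[C [CQ LC ->]]].
  by rewrite !inE => /andP[CQ LC] ->; exists C.
by exists C; rewrite // !inE CQ.
Qed.

Lemma assignS N Q L : N `<=` Q -> assign N L `<=` assign Q L.
Proof.
move=> /fsubsetP sNQ; apply/fsubsetP => D /assignP[C [CN LC ->]].
by apply/assignP; exists C; split; rewrite ?sNQ.
Qed.

Lemma lits_assign Q L M : M \in lits (assign Q L) -> M \in lits Q /\ M.2 <> L.2.
Proof.
case/litsP => D /assignP[C [CQ LC ->]]; rewrite !inE => /andP[MnL MC].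
split; first by apply/litsP; exists C.
by case/eq_atom => e; move: MnL LC; rewrite -?e ?MC ?eqxx.
Qed.

Lemma assign_unsat Q L : ~ satisfiable Q -> ~ satisfiable (assign Q L).
Proof.
move=> unsatQ [v vP]; apply: unsatQ.
(* Forcing [L] true satisfies the deleted clauses; the others keep a literal over a different
   atom. *)
exists (fun a => if a == L.2 then L.1 else v a) => C CQ.
have [LC|LC] := boolP (L \in C).
  by exists L => //; rewrite /lit_true eqxx.
have CQ' : C `\ neg L \in assign Q L by apply/assignP; exists C.
have [M MC vM] := vP _ CQ'.
have [|_ /eqP/negPf ML] := @lits_assign Q L M.
  by apply/litsP; exists (C `\ neg L).
exists M; last by rewrite /lit_true ML.
by move: MC; rewrite !inE => /andP[].
Qed.

Lemma unsat_has_lit Q :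
  ~ satisfiable Q -> fset0 \notin Q -> exists L, L \in lits Q.
Proof.
move=> unsatQ Q0.
case: (fset_0Vmem (lits Q)) => [lits0|[L LQ]]; last by exists L.
case: unsatQ; exists (fun=> true) => C CQ.
case: (fset_0Vmem C) => [C0|[L LC]]; first by rewrite -C0 CQ in Q0.
have: L \in lits Q by apply/litsP; exists C.
by rewrite lits0 inE.
Qed.

Definition atoms Q : {fset T} := [fset L.2 | L in lits Q].

(** If no atom had both signs, making true exactly the atoms that occur positively would satisfy
    every clause. *)
Lemma unsat_both_signs Q :
  ~ satisfiable Q -> fset0 \notin Q ->
  exists2 L, L \in lits Q & neg L \in lits Q.
Proof.
move=> unsatQ Q0; apply: contrapT => noL; apply: unsatQ.
exists (fun a => (true, a) \in lits Q) => C CQ.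
case: (fset_0Vmem C) => [C0|[[b a] LC]]; first by rewrite -C0 CQ in Q0.
have LQ : (b, a) \in lits Q by apply/litsP; exists C.
exists (b, a); rewrite // /lit_true /=; case: b {LC} LQ => [->//|LQ].
by rewrite eqbF_neg; apply/negP => LQ'; apply: noL; exists (true, a).
Qed.

(** Dropping a literal whose complement also occurs loses no atom. *)
Lemma card_atoms_lt Q :
  ~ satisfiable Q -> fset0 \notin Q -> #|` atoms Q| < #|` lits Q|.
Proof.
move=> unsatQ Q0; have [L LQ nLQ] := unsat_both_signs unsatQ Q0.
rewrite (cardfsD1 L (lits Q)) LQ add1n ltnS.
have /fsubset_leq_card/leq_trans : atoms Q `<=` [fset M.2 | M in lits Q `\ L].
  apply/fsubsetP => _ /imfsetP[M /= MQ ->].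
  have [->|ML] := eqVneq M L; last first.
    by apply/imfsetP; exists M; rewrite //= !inE ML.
  apply/imfsetP; exists (neg L) => //=; rewrite !inE nLQ andbT.
  by apply/eqP => /(congr1 fst) /=; case: L.1.
by apply; apply: leq_imfset_card.
Qed.

End Literals.

(** * Reachability through true literals, and finiteness of the radius *)

Section Reachability.
Variables (T : choiceType) (S U : clauses T).
Hypothesis sUS : U `<=` S.

Inductive reach_true (v : T -> bool) : clause T -> Prop :=
| reach_start C : C \in U -> reach_true v C
| reach_step C L D : reach_true v C -> L \in C -> lit_true v L ->
    D \in S -> neg L \in D -> reach_true v D.

Lemma reach_trueS v C : reach_true v C -> C \in S.
Proof. by case=> {}C // /(fsubsetP sUS). Qed.

(* The entry literal [Ms n] is the complement of a true literal, hence false,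
   so a true exit literal always differs from it.  The literal [L0] only makes
   the sequences [Ls] and [Ms] exist. *)
Lemma reach_true_path (L0 : literal T) v C : reach_true v C ->
  exists n Cs Ls Ms, [/\ alternating_path S n Cs Ls Ms, Cs 1 \in U, Cs n = C
    & 1 < n -> ~~ lit_true v (Ms n)].
Proof.
elim=> {C} [C CU|C L D _ [n [Cs [Ls [Ms [pathC C1 Cn Mn]]]]] LC vL DS LD].
  exists 1, (fun=> C), (fun=> L0), (fun=> L0); split=> //; split=> // [i _|i|i].
  - exact: (fsubsetP sUS).
  - by case: i => [|[]].
  - by case: i => [|[]].
case: pathC => n1 CsS link alt.
exists n.+1, (fun i => if i <= n then Cs i else D),
  (fun i => if i < n then Ls i else L),
  (fun i => if i <= n then Ms i else neg L).
rewrite n1 ltnn lit_true_neg vL; split=> //; split=> // [i|i|i].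
- case/andP=> i1 _; case: leqP => // i_le; exact/CsS/andP.
- case/andP=> i1; rewrite ltnS leq_eqVlt => /orP[/eqP->|i_lt].
    by rewrite ltnn eqxx Cn negK.
  by rewrite i_lt orbT; apply/link/andP.
- case/andP=> i1; rewrite ltnS leq_eqVlt => /orP[/eqP i_n|i_lt].
    rewrite i_n ltnn eqxx /= => LM.
    by rewrite i_n in i1; have /negP := Mn i1; rewrite -LM.
  by rewrite i_lt orbT; apply/alt/andP.
Qed.

Lemma reach_true_dist (L0 : literal T) v C :
  reach_true v C -> exists n, set_dist S U C = Some n.
Proof.
case/(reach_true_path L0) => n [Cs [Ls [Ms [pathC C1 Cn _]]]].
have [m dm _] : exists2 m, dist S (Cs 1) C = Some m & m <= n.
  by apply: min_nat_exists; exists Cs, Ls, Ms.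
have [|k dk _] := @min_nat_exists
  (fun n => exists2 D, D \in U & dist S D C = Some n) m; first by exists (Cs 1).
by exists k.
Qed.

(** Follow [v] on atoms whose [v]-true literal lies in a reachable clause, and [w] elsewhere. If [v]
    overrides the [w]-true literal of an unreachable clause and falsifies it, the complement lies in
    a reachable clause, from which one step reaches that clause: a contradiction. *)
Lemma reach_true_sat v w :
  (forall C, reach_true v C -> exists2 L, L \in C & lit_true v L) ->
  (forall C, C \in S `\` U -> exists2 L, L \in C & lit_true w L) ->
  satisfiable S.
Proof.
move=> vP wP.
pose exit (L : literal T) :=
  `[< exists C, [/\ reach_true v C, L \in C & lit_true v L] >].
exists (fun a => if exit (v a, a) then v a else w a) => C CS.
have exitE L : lit_true v L -> (v L.2, L.2) = L.
  by case: L => b a /eqP /= ->.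
case: (pselect (reach_true v C)) => [rC|nrC].
  have [L LC vL] := vP _ rC; exists L => //.
  rewrite /lit_true exitE //; have -> : exit L by apply/asboolP; exists C.
  exact: vL.
have [|L LC wL] := wP C.
  by rewrite !inE CS andbT; apply/negP => /(reach_start v).
exists L => //; rewrite /lit_true; case: ifP => // /asboolP [D [rD LD vD]].
have [//|vL] := boolP (lit_true v L); case: nrC.
apply: (reach_step rD LD vD CS).
suff -> : (v L.2, L.2) = neg L by rewrite negK.
by move: vL; rewrite /lit_true /neg; case: (v _) => /=; case: L.1.
Qed.

Lemma support_radius_finite : ~ satisfiable S -> support_set S U ->
  fset0 \notin S -> exists m, support_radius S U = Some m.
Proof.
move=> unsatS [_ suppU] S0; have [L0 _] := unsat_has_lit unsatS S0.
suff [m um] : exists m, ~ satisfiable (relevant S U m).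
  have [k rad _] :=
    min_nat_exists (P := fun m => ~ satisfiable (relevant S U m)) um.
  by exists k.
(* The largest finite distance: at this radius every clause at finite distance is included. *)
exists (\max_(C <- S) odflt 0 (set_dist S U C)) => -[v vP].
have [w wP] : satisfiable (S `\` U).
  apply: contrapT => /(suppU _ (fsubsetDl _ _)) /fset0Pn [C].
  by rewrite !inE andbAC andNb.
apply: unsatS; apply: (@reach_true_sat v w) => // C rC; apply: vP.
have CS := reach_trueS rC; have [n dn] := reach_true_dist L0 rC.
rewrite !inE CS dn /=.
have := @leq_bigmax_seq _ _ xpredT
  (fun C => odflt 0 (set_dist S U C)) _ CS isT.
by rewrite dn.
Qed.

(** * Levels of the stepping sequence versus the neighborhood *)

Lemma set_dist_gt0 C n : set_dist S U C = Some n -> 0 < n.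
Proof. by case/min_nat_holds => D _ /min_nat_holds [Cs [Ls [Ms [[]]]]]. Qed.

Lemma relevantP m C :
  reflect (C \in S /\ exists2 n, set_dist S U C = Some n & n <= m)
    (C \in relevant S U m).
Proof.
rewrite !inE /=; apply: (iffP andP) => -[CS].
  by case: (set_dist S U C) => // n n_le; split=> //; exists n.
by case=> n -> n_le.
Qed.

Lemma nth_stepping i L : L \in nth fset0 (stepping_sequence S U) i ->
  L \in stepping_level S U i.+1.
Proof.
rewrite /stepping_sequence; set n := \max_(_ <- _) _ => Li.
have i_lt : i < n.
  rewrite ltnNge; apply/negP => n_le; move: Li.
  by rewrite nth_default ?inE // size_map size_iota.
by move: Li; rewrite (nth_map 0) ?size_iota // nth_iota.
Qed.

(** A literal is no farther from [U] than any clause containing it. Distances start at 1 and indices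
    at 0, so distance [i] sits at index [i.-1]. *)
Lemma stepping_relevant m L : L \in lits (relevant S U m) ->
  exists2 i, i < m & L \in nth fset0 (stepping_sequence S U) i.
Proof.
case/litsP => C /relevantP[CS [n dn n_le]] LC.
have LS : L \in lits S by apply/litsP; exists C.
have [|i di i_le] := @min_nat_exists (fun n => exists C,
    [/\ C \in S, set_dist S U C = Some n & (L \in C) || (neg L \in C)]) n.
  by exists C; rewrite LC.
have i0 : 0 < i by have [D [_ /set_dist_gt0]] := min_nat_holds di.
rewrite -/(lit_dist S U L) in di.
have i_max := @leq_bigmax_seq _ _ xpredT
  (fun L => odflt 0 (lit_dist S U L)) _ LS isT.
rewrite di /= in i_max.
exists i.-1; first by rewrite prednK // (leq_trans i_le).
rewrite (nth_map 0) ?size_iota ?nth_iota ?prednK // add1n prednK //.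
by rewrite !inE LS di eqxx.
Qed.

(** Only the atom is certain to occur: the clause that realizes the distance of [L] may contain just
    [neg L]. *)
Lemma stepping_atoms m i L : i < m ->
  L \in nth fset0 (stepping_sequence S U) i -> L.2 \in atoms (relevant S U m).
Proof.
move=> i_lt /nth_stepping; rewrite !inE => /andP[_ /eqP/min_nat_holds].
case=> C [CS dC LC].
have CR : C \in relevant S U m by apply/relevantP; split=> //; exists i.+1.
case/orP: LC => LC; apply/imfsetP.
  by exists L => //=; apply/litsP; exists C.
by exists (neg L) => //=; apply/litsP; exists C.
Qed.

End Reachability.

(** * Invariants and the call bound along a run *)

Section Run.
Variable T : choiceType.
Implicit Types (Q N : clauses T) (StepR : seq {fset literal T}) (A : {fset T}).

Definition covers StepR m N := forall L, L \in lits N ->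
  exists2 i, i < m & L \in nth fset0 StepR i.

Definition steps_within StepR m A := forall i L, i < m ->
  L \in nth fset0 StepR i -> L.2 \in A.

Lemma nth_step_restrict StepR Q i :
  nth fset0 (step_restrict StepR Q) i = nth fset0 StepR i `&` lits Q.
Proof.
have [i_lt|i_ge] := ltnP i (size StepR); first by rewrite (nth_map fset0).
by rewrite !nth_default ?size_map // fset0I.
Qed.

Lemma covers_assign StepR m N Q L : N `<=` Q -> covers StepR m N ->
  covers (step_restrict StepR (assign Q L)) m (assign N L).
Proof.
move=> sNQ cov M MN; have [MN' _] := lits_assign MN.
have [i i_lt Mi] := cov _ MN'; exists i; rewrite // nth_step_restrict inE Mi.
case/litsP: MN => C /(fsubsetP (assignS _ sNQ)) CQ MC.
by apply/litsP; exists C.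
Qed.

Lemma steps_within_assign StepR m A Q L : steps_within StepR m A ->
  steps_within (step_restrict StepR (assign Q L)) m (A `\ L.2).
Proof.
move=> inA i M i_lt; rewrite nth_step_restrict inE => /andP[Mi].
by case/lits_assign => _ /eqP ML; rewrite !inE ML (inA i).
Qed.

(** [N] still has a literal, at some index below [m], and the first nonempty level comes no
    later. *)
Lemma leading_atom StepR m N A L : ~ satisfiable N -> fset0 \notin N ->
  covers StepR m N -> steps_within StepR m A -> leading StepR L -> L.2 \in A.
Proof.
move=> unsatN N0 cov inA [i [lt_i _ Li]].
have [M /cov[j j_lt Mj]] := unsat_has_lit unsatN N0.
have i_lt : i < m.
  rewrite (leq_ltn_trans _ j_lt) // leqNgt; apply/negP => /lt_i j0.
  by rewrite j0 in Mj.
by case/orP: Li => [|/(inA i (neg L))]; [apply: inA|apply].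
Qed.

(** [N] is what remains of the neighborhood and [A] contains its unassigned atoms; each branching
    removes one atom from [A]. The strict inequality absorbs the call itself: two counts below [x]
    and one more call stay below [2 * x]. *)
Lemma dpll_rel_bound m Q StepR r c : dpll_rel Q StepR r c ->
  forall N A, N `<=` Q -> ~ satisfiable N -> covers StepR m N ->
  steps_within StepR m A -> c < 2 ^ #|` A|.+1.
Proof.
have base A : 1 < 2 ^ #|` A|.+1 by rewrite expnS leq_pmulr ?expn_gt0.
have step Q' R L N A : fset0 \notin Q' -> leading R L ->
    N `<=` Q' -> ~ satisfiable N -> covers R m N -> steps_within R m A ->
    #|` A| = #|` A `\ L.2|.+1.
  move=> Q0 lead sNQ unsatN cov inA.
  have N0 : fset0 \notin N by apply: contra Q0; apply: (fsubsetP sNQ).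
  by rewrite (cardfsD1 L.2 A) (leading_atom unsatN N0 cov inA lead).
elim=> {Q StepR r c} // [Q StepR L c|Q StepR L c1 r c2] Q0 _ lead _ IH.
  move=> N A sNQ unsatN cov inA.
  have := IH _ _ (assignS L sNQ) (assign_unsat unsatN)
    (covers_assign sNQ cov) (steps_within_assign inA).
  rewrite (step _ _ _ _ _ Q0 lead sNQ unsatN cov inA) !expnS.
  by move: (2 ^ _) => x; lia.
move=> _ IH2 N A sNQ unsatN cov inA.
have {IH} := IH _ _ (assignS L sNQ) (assign_unsat unsatN)
  (covers_assign sNQ cov) (steps_within_assign inA).
have {IH2} := IH2 _ _ (assignS (neg L) sNQ) (assign_unsat unsatN)
  (covers_assign sNQ cov) (steps_within_assign inA).
rewrite (step _ _ _ _ _ Q0 lead sNQ unsatN cov inA) !expnS /=.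
by move: (2 ^ _) => x; lia.
Qed.

End Run.

Theorem theorem9 (T : choiceType) (S U : clauses T) (r : answer) (c : nat) :
  ~ satisfiable S ->
  support_set S U ->
  dpll_rel S (stepping_sequence S U) r c ->
  c <= 2 ^ #|` lits (support_neighborhood S U)|.
Proof.
move=> unsatS suppU run.
have [S0|S0] := boolP (fset0 \in S).
  suff -> : c = 1 by rewrite expn_gt0.
  (* With the empty clause in [S], the top call returns at once. *)
  by case: run S0 => // [Q R L ?|Q R L ? ? ?] /negPf ->.
have [m rad] := support_radius_finite (proj1 suppU) unsatS suppU S0.
rewrite /support_neighborhood rad.
have unsatN : ~ satisfiable (relevant S U m) := min_nat_holds rad.
have sNS : relevant S U m `<=` S by apply/fsubsetP => C /relevantP[].
have N0 : fset0 \notin relevant S U m.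
  by apply: contra S0; apply: (fsubsetP sNS).
have /ltnW/leq_trans := dpll_rel_bound run sNS unsatN
  (@stepping_relevant _ S U m) (@stepping_atoms _ S U m).
by apply; rewrite leq_exp2l // card_atoms_lt.
Qed.
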